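(* Let $K$ be a field, $S=K[x_1,\ldots,x_n]$, and let $I\subset S$ be a monomial ideal which has a regular linear quotient. Then the labelled regular cell complex $X_I$ (constructed from a degree increasing admissible order $u_1,\ldots,u_m$ of $G(I)$ with regular decomposition function $\mathfrak{g}$) supports the minimal free resolution of $I$.
   Context: Linear quotients. $G(I)$ is the unique minimal set of monomial generators of $I$ and $M(I)$ the set of all monomials in $I$. A linear ordering $u_1,\ldots,u_m$ of $G(I)$ is an admissible order if for all $2\le j\le m$ the colon ideal $\langle u_1,\ldots,u_{j-1}\rangle:u_j$ is generated by a subset $\mathfrak{q}(u_j)$ of the variables (and $\mathfrak{q}(u_1)=\emptyset$). $I$ has a linear quotient if $G(I)$ admits an admissible order. Throughout, all admissible orders are assumed degree increasing: $\deg u_1\le\cdots\le\deg u_m$. The decomposition function of an admissible order is $\mathfrak{g}:M(I)\to G(I)$ with $\mathfrak{g}(v)=u_j$, where $j$ is the smallest index with $v\in I_j:=\langle u_1,\ldots,u_j\rangle$. It is regular if $\mathfrak{q}(\mathfrak{g}(yu_j))\subseteq\mathfrak{q}(u_j)$ for every $j$ and every $y\in\mathfrak{q}(u_j)$. $I$ has a regular linear quotient if it admits an admissible order with a regular decomposition function. For $\sigma\subseteq\mathfrak{q}(u)$, $u\in G(I)$, put $\mathfrak{g}(\sigma;u):=\mathfrak{g}(u\prod_{y\in\sigma}y)$. The complex $X_I$. Fix a (degree increasing) admissible order $u_1,\ldots,u_m$ with regular decomposition function $\mathfrak{g}$. $X_1$ is the single vertex $u_1$. Given the regular cell complex $X_{j-1}$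 with vertices $u_1,\ldots,u_{j-1}$, let $u=u_j$ be a new point and $l=|\mathfrak{q}(u)|$. Let $X(u)$ be the subcomplex of $X_{j-1}$ induced by the vertices $\mathfrak{g}(\sigma;u)$, $\emptyset\ne\sigma\subseteq\mathfrak{q}(u)$ (all cells of $X_{j-1}$ whose vertices all lie in this set); for a proper subset $\sigma\subset\mathfrak{q}(u)$ let $X(\sigma,u)$ be the subcomplex of $X_{j-1}$ induced by the vertices $\mathfrak{g}(\tau;u)$, $\emptyset\neq\tau\subseteq\sigma$. (It is known that $X(u)$ is a ball of dimension $l-1$ and $X(\sigma,u)$ is a ball of dimension $|\sigma|-1$, so the following makes sense.) For each proper subset $\sigma$ of $\mathfrak{q}(u)$ let $B(\sigma,u):=\{u\}\ast X(\sigma,u)$ (the cone with apex $u$; $B(\emptyset,u)=\{u\}$), regarded as a single cell of dimension $|\sigma|$; these give a cell decomposition of $\{u\}\ast\partial X(u)$. Let $B(u)=B(\mathfrak{q}(u),u)$ be an $l$-ball glued along its boundary to $X(u)\cup(\{u\}\ast\partial X(u))$. Then $X_j:=X_{j-1}\cup\{B(u)\}\cup\bigcup_{\sigma\subsetneq\mathfrak{q}(u)}\{B(\sigma,u)\}$, and $X_I:=X_m$. The vertex $u_j$ is labelled by the monomial $u_j$ and each cell by the least common multiple of the labels of its vertices. Supporting a resolution. For a regular cell complex $X$ whose vertices are labelled by the monomials in $G(I)$ and whose cells $c$ are labelled by the lcm $m_c$ of the labels of their vertices (with $m_\emptyset=1$), let $\mathbf{F}_X$ be the complex of free multigraded $S$-modules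 with one basis element $e_c$ of multidegree $m_c$ for each cell $c$ (including $\emptyset$), in homological degree $\dim c+1$, and differential $\partial(e_c)=\sum_{c'}[c:c']\frac{m_c}{m_{c'}}e_{c'}$, the sum over codimension-one faces $c'$ of $c$ and $[c:c']$ the incidence numbers of the (augmented) cellular chain complex. $X$ supports the minimal free resolution of $I$ if $\mathbf{F}_X$ is a minimal free resolution of $S/I$ (equivalently, dropping the empty cell, one gets a minimal free resolution of $I$). *)

(* Defs.v *)
From HB Require Import structures.
From mathcomp Require Import all_boot all_order all_algebra.
From mathcomp Require Export mpoly.
From mathcomp Require Import boolp classical_sets functions set_interval.
From mathcomp Require Import reals topology.

Set Implicit Arguments.
Unset Strict Implicit.
Unset Printing Implicit Defensive.

Import Order.TTheory GRing.Theory Num.Theory.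
Import numFieldTopology.Exports.

Local Open Scope classical_set_scope.
Local Open Scope ring_scope.

(* Ideals are Prop-valued sets: the library's idealr_closed is boolean and
   excludes the unit ideal. *)
Section Ideals.
Variable S : comNzRingType.

Definition is_ideal (I : set S) : Prop :=
  [/\ I 0, forall p q, I p -> I q -> I (p + q) & forall a p, I p -> I (a * p)].

Definition ideal_gen (A : set S) : set S := smallest is_ideal A.

Definition colon (I : set S) (b : S) : set S := [set a | I (a * b)].

End Ideals.

(* A monomial of S = K[x_1, ..., x_n] is given by its exponent vector
   m : 'X_{1..n}; the product of monomials is the sum of exponent vectors. *)
Section LinearQuotients.
Variables (K : fieldType) (n : nat).
Local Notation S := {mpoly K[n]}.
Local Notation mon := 'X_{1..n}.

Definition monomial_gen (A : set mon) : set S :=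
  ideal_gen [set 'X_[m] | m in A].

Definition variable_gen (s : {set 'I_n}) : set S :=
  ideal_gen [set 'X_i | i in [set` s]].

Definition monomial_ideal (I : set S) : Prop :=
  exists A : set mon, I = monomial_gen A.

Definition minimal_gens (I : set S) (G : set mon) : Prop :=
  monomial_gen G = I /\
  forall G' : set mon, G' `<=` G -> monomial_gen G' = I -> G' = G.

(* <u_1, ..., u_j>; positions in the sequence u are counted from 0, so u_j is
   nth 0 u j.-1. *)
Definition initial_ideal (u : seq mon) (j : nat) : set S :=
  monomial_gen [set` take j u].

(* For j = 0 the colon ideal is zero, which forces q (u_1) to be empty. *)
Definition admissible (I : set S) (u : seq mon) (q : mon -> {set 'I_n}) : Prop :=
  [/\ uniq u,
      minimal_gens I [set` u],
      sorted leq [seq mdeg m | m <- u]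
    & forall j, (j < size u)%N ->
        colon (initial_ideal u j) 'X_[nth 0%MM u j]
          = variable_gen (q (nth 0%MM u j))].

(* The value is only meaningful for v in M(I). *)
Definition decomp (u : seq mon) (v : mon) : mon :=
  nth 0%MM u
    (find (fun j => `[< initial_ideal u j.+1 'X_[v] >]) (iota 0 (size u))).

Definition regular_decomp (u : seq mon) (q : mon -> {set 'I_n}) : Prop :=
  forall w y, w \in u -> y \in q w ->
    q (decomp u (U_(y) + w)%MM) \subset q w.

Definition decomp_at (u : seq mon) (s : {set 'I_n}) (w : mon) : mon :=
  decomp u (w + \sum_(y in s) U_(y))%MM.

End LinearQuotients.

Section CellComplexes.
Variable R : realType.

(* 'rV[R]_d carries the product topology, which is the Euclidean one. *)
Definition closed_unit_ball (d : nat) : set 'rV[R]_d :=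
  [set x | \sum_(i < d) x ord0 i ^+ 2 <= 1].
Definition open_unit_ball (d : nat) : set 'rV[R]_d :=
  [set x | \sum_(i < d) x ord0 i ^+ 2 < 1].
Arguments closed_unit_ball : clear implicits.
Arguments open_unit_ball : clear implicits.

(* A finite regular CW complex, given by its nonempty open cells.  A continuous
   injection of the compact ball into a Hausdorff space is a homeomorphism onto
   its image. *)
Record regular_cell_complex := RegularCellComplex {
  space : topologicalType;
  cell : finType;
  dim : cell -> nat;
  ocell : cell -> set space;
  space_hausdorff : hausdorff_space space;
  cell_ball : forall c, exists f : 'rV[R]_(dim c) -> space,
    [/\ {within closed_unit_ball (dim c), continuous f},
        set_inj (closed_unit_ball (dim c)) f,
        f @` closed_unit_ball (dim c) = closure (ocell c)
      & f @` open_unit_ball (dim c) = ocell c];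
  cell_disjoint : trivIset setT ocell;
  cell_cover : \bigcup_c ocell c = setT;
  cell_boundary : forall c x, closure (ocell c) x -> ~ ocell c x ->
    exists c', [/\ (dim c' < dim c)%N, ocell c' x
                 & closure (ocell c') `<=` closure (ocell c)]
}.

Variable X : regular_cell_complex.

Definition ccell (c : cell X) : set (space X) := closure (ocell c).
Definition face (c' c : cell X) : Prop := ccell c' `<=` ccell c.
Definition vertex_of (v c : cell X) : Prop := dim v = 0%N /\ face v c.

Definition subcomplex (A : set (cell X)) : Prop :=
  forall c c', A c -> face c' c -> A c'.
Definition support (A : set (cell X)) : set (space X) := \bigcup_(c in A) ccell c.
Definition induced (A V : set (cell X)) : set (cell X) :=
  [set c | A c /\ forall v, vertex_of v c -> V v].

(* h exhibits the cone {a} * L over L inside the ambient space; h (x, t) runs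
   from x (t = 0) to the apex a (t = 1), and the cone meets Y only in L. *)
Definition cone_map (Y L : set (space X)) (a : space X)
    (h : space X * R -> space X) : Prop :=
  [/\ {within L `*` `[0, 1], continuous h},
      forall x, L x -> h (x, 0) = x /\ h (x, 1) = a,
      set_inj (L `*` `[0, 1[) h,
      forall x t, L x -> 0 <= t < 1 -> h (x, t) <> a
    & forall x t, L x -> 0 < t <= 1 -> ~ Y (h (x, t))].

Definition cone (a : space X) (h : space X * R -> space X) (L : set (space X)) :
    set (space X) := [set a] `|` h @` (L `*` `[0, 1]).

End CellComplexes.

Section Construction.
Variables (K : fieldType) (n : nat) (R : realType).
Variables (u : seq 'X_{1..n}) (q : 'X_{1..n} -> {set 'I_n}).
Variable X : regular_cell_complex R.
(* B s w is the cell B(s, w); only the values with s \subset q w, w \in u,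
   matter. *)
Variable B : {set 'I_n} -> 'X_{1..n} -> cell X.
Local Notation "u_[ j ]" := (nth 0%MM u j) (at level 0, format "u_[ j ]").

(* X_j, as the set of cells B(s, u_i) with i <= j. *)
Definition stage (j : nat) : set (cell X) :=
  [set c | exists (i : nat) (s : {set 'I_n}),
     [/\ (i < j)%N, (i < size u)%N, s \subset q u_[i] & c = B s u_[i]]].

(* X(s, u_[j]), the subcomplex of the previous stage induced by the vertices
   g(t; u_[j]) with t a nonempty subset of s; X(u_[j]) is the case
   s = q u_[j]. *)
Definition base (j : nat) (s : {set 'I_n}) : set (cell X) :=
  induced (stage j)
    [set B finset.set0 (decomp_at K u t u_[j]) |
      t in [set t : {set 'I_n} | t != finset.set0 /\ t \subset s]].

(* Subset of X_{j-1} underlying the boundary of the ball X(u_[j]). *)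
Definition base_boundary (j : nat) : set (space X) :=
  \bigcup_(s in [set s : {set 'I_n} | s \proper q u_[j]]) support (base j s).

Record is_X_I : Prop := IsXI {
  XI_cells : forall c, stage (size u) c;
  XI_distinct : forall (w w' : 'X_{1..n}) (s s' : {set 'I_n}),
    w \in u -> w' \in u -> s \subset q w -> s' \subset q w' ->
    B s w = B s' w' -> w = w' /\ s = s';
  XI_dim : forall w (s : {set 'I_n}), w \in u -> s \subset q w -> dim (B s w) = #|s|;
  XI_stage : forall j, (j <= size u)%N -> subcomplex (stage j);
  XI_proper : forall j, (j < size u)%N -> exists a h,
    [/\ ocell (B finset.set0 u_[j]) = [set a],
        ~ support (stage j) a,
        cone_map (support (stage j)) (base_boundary j) a h
      & forall s : {set 'I_n}, s \proper q u_[j] ->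
          ccell (B s u_[j]) = cone a h (support (base j s))];
  XI_top : forall j, (j < size u)%N ->
    ccell (B (q u_[j]) u_[j]) `\` ocell (B (q u_[j]) u_[j])
    = support (base j (q u_[j])) `|`
      \bigcup_(s in [set s : {set 'I_n} | s \proper q u_[j]]) ccell (B s u_[j])
}.

End Construction.

(* Complexes of finite free modules with chosen bases, indexed by homological
   degree; the basis element e_c of degree i.+1 is sent to
   \sum_c' mat i c c' e_c'. *)
Record based_complex (S : comNzRingType) := BasedComplex {
  basis : nat -> finType;
  mat : forall i, basis i.+1 -> basis i -> S
}.

Section FreeResolutions.
Variables (S : comNzRingType) (C : based_complex S).

Definition chain (i : nat) := {ffun basis C i -> S}.

Definition diff (i : nat) (f : chain i.+1) : chain i :=
  [ffun c' => \sum_c f c * mat c c'].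

Definition exact_positive : Prop :=
  forall i (f : chain i.+1), diff f = 0 <-> exists f' : chain i.+2, f = diff f'.

(* The linear map F_0 -> S with e_c |-> a c. *)
Definition aug (a : basis C 0 -> S) (f : chain 0) : S := \sum_c f c * a c.

Definition resolves_ideal (I : set S) (a : basis C 0 -> S) : Prop :=
  [/\ forall p, I p <-> exists f, p = aug a f,
      forall f, aug a f = 0 <-> exists f' : chain 1, f = diff f'
    & exact_positive].

(* Same for the composite F_0 -> S -> S/I. *)
Definition resolves_quotient (I : set S) (a : basis C 0 -> S) : Prop :=
  [/\ forall p, exists f, I (p - aug a f),
      forall f, I (aug a f) <-> exists f' : chain 1, f = diff f'
    & exact_positive].

(* The image of each F_{i+1} lies in mF_i. *)
Definition minimal_wrt (m : set S) : Prop :=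
  forall i (f : chain i.+1) c, m (diff f c).

End FreeResolutions.

Definition shift (S : comNzRingType) (C : based_complex S) : based_complex S :=
  @BasedComplex S (fun i => basis C i.+1) (fun i => @mat S C i.+1).

Section CellularResolutions.
Variables (K : fieldType) (n : nat) (R : realType).
Variable X : regular_cell_complex R.
Local Notation S := {mpoly K[n]}.

(* The cells of X together with the empty cell None. *)
Definition acell := option (cell X).

Definition hdeg (c : acell) : nat := if c is Some c' then (dim c').+1 else 0.

Definition aface (c' c : acell) : Prop :=
  match c', c with
  | None, _ => True
  | Some _, None => False
  | Some d', Some d => face d' d
  end.

(* eps c c' is the incidence number [c : c'].  These are the classical axioms
   (Massey, Bruns-Herzog) which characterize, up to orientation of the cells,
   the incidence numbers of the augmented cellular chain complex. *)
Record incidence (eps : acell -> acell -> int) : Prop := Incidence {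
  incidence_face : forall c c', hdeg c = (hdeg c').+1 -> aface c' c ->
    eps c c' = 1 \/ eps c c' = -1;
  incidence_nonface : forall c c', hdeg c = (hdeg c').+1 -> ~ aface c' c ->
    eps c c' = 0;
  incidence_empty : forall v : cell X, dim v = 0%N -> eps (Some v) None = 1;
  incidence_square : forall c c'', hdeg c = (hdeg c'').+2 ->
    \sum_(c' | hdeg c' == (hdeg c'').+1) eps c c' * eps c' c'' = 0
}.

(* Only the values of lab on the vertices are used. *)
Variable lab : cell X -> 'X_{1..n}.

Definition alabel (c : acell) : 'X_{1..n} :=
  if c is Some d then
    \big[@mlcm n/0%MM]_(v | `[< vertex_of v d >]) lab v
  else 0%MM.

Definition cellular_complex (eps : acell -> acell -> int) : based_complex S :=
  @BasedComplex S
    (fun i => {c : acell | hdeg c == i} : finType)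
    (fun i c c' => (eps (val c) (val c'))%:~R *
                   'X_[(alabel (val c) - alabel (val c'))%MM]).

Definition empty_cell : {c : acell | hdeg c == 0%N} := exist _ None (eqxx 0%N).

Definition max_ideal : set S := variable_gen [set: 'I_n]%SET.

(* The second clause, about S/I, is restricted to proper I: for I = S the map
   S e_v -> S e_emptyset is the identity, so only the first one is minimal. *)
Definition supports_minimal_resolution (I : set S) : Prop :=
  forall eps, incidence eps ->
    (resolves_ideal (C := shift (cellular_complex eps)) I
       (fun c => mat (b := cellular_complex eps) (i := 0) c empty_cell) /\
     minimal_wrt (shift (cellular_complex eps)) max_ideal) /\
    (~ I 1 ->
     resolves_quotient (C := cellular_complex eps) I (fun=> 1) /\
     minimal_wrt (cellular_complex eps) max_ideal).

End CellularResolutions.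

(* Main.v *)
Require Import Defs.
From mathcomp Require Import all_boot all_order all_algebra mpoly.

(* Write K_j for the free complex on the stage X_j.  The quotient K_j / K_{j-1}
   has a basis element for each B(s, u_j), s a subset of q(u_j).  The label of
   B(s, u_j) is u_j times the product of s, and B(t, u_j) is a face of B(s, u_j)
   exactly when t is a subset of s, so the quotient is a Koszul complex on the
   variables of q(u_j), up to signs about which only d^2 = 0 is known.  It
   resolves S/<q(u_j)>, which is I_j / I_{j-1} because <q(u_j)> is the colon
   ideal; so if K_{j-1} resolves I_{j-1} then K_j resolves I_j.  The topology of
   X_I is only needed to find the vertices of B(s, u_j). *)

Set Implicit Arguments.
Unset Strict Implicit.
Unset Printing Implicit Defensive.
Import Order.TTheory GRing.Theory Num.Theory.

(** * Koszul complexes with arbitrary compatible signs *)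

Section Koszul.
Local Open Scope ring_scope.
Variables (S : comNzRingType) (T : finType) (x : T -> S).
Implicit Types (q r s t : {set T}) (y z : T) (p : S) (e : {set T} -> {set T} -> S).
Implicit Types (g h : {set T} -> S).

Definition lin_span q p := exists c : T -> S, p = \sum_(i in q) c i * x i.

Lemma lin_spanM q a p : lin_span q p -> lin_span q (a * p).
Proof.
case=> c ->; exists (fun i => a * c i).
by rewrite mulr_sumr; apply: eq_bigr => i _; rewrite mulrA.
Qed.

(** A new head adds a zero diagonal term and cancelling pairs. No division by two occurs, so
    characteristic two is covered. *)
Lemma sum_alternating (r : seq T) (F : T -> T -> S) :
  (forall y, F y y = 0) -> (forall y z, F y z + F z y = 0) ->
  \sum_(y <- r) \sum_(z <- r) F y z = 0.
Proof.
move=> F0 FN; elim: r => [|a r IH]; first by rewrite big_nil.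
rewrite big_cons big_cons F0 add0r.
under [X in _ + X]eq_bigr do rewrite big_cons.
by rewrite big_split /= IH addr0 -big_split /= big1.
Qed.

(** A chain [g] has components in all Koszul degrees at once. Its value at [set0] is never read,
    since [y |: t] is nonempty. *)
Definition kdiff e q g t : S := \sum_(y in q :\: t) e (y |: t) t * x y * g (y |: t).

(** The second clause says that the two paths from [y |: (z |: t)] down to [t] cancel, which makes
    the differential square to zero. *)
Definition koszul_signs e q :=
  (forall t y, t \subset q -> y \in q :\: t -> e (y |: t) t ^+ 2 = 1) /\
  (forall t y z, t \subset q -> y \in q :\: t -> z \in q :\: t -> y != z ->
     e (y |: (z |: t)) (z |: t) * e (z |: t) t
     + e (z |: (y |: t)) (y |: t) * e (y |: t) t = 0).

Lemma eq_kdiff e q g h t : (forall y, y \in q :\: t -> g (y |: t) = h (y |: t)) ->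
  kdiff e q g t = kdiff e q h t.
Proof. by move=> gh; apply: eq_bigr => y /gh->. Qed.

Lemma kdiffD e q g h t : kdiff e q (fun s => g s + h s) t = kdiff e q g t + kdiff e q h t.
Proof. by rewrite -big_split; apply: eq_bigr => y _; rewrite mulrDr. Qed.

Lemma kdiffB e q g h t : kdiff e q (fun s => g s - h s) t = kdiff e q g t - kdiff e q h t.
Proof. by rewrite -sumrB; apply: eq_bigr => y _; rewrite mulrBr. Qed.

Lemma kdiff_kdiff e q g t : koszul_signs e q -> t \subset q ->
  kdiff e q (kdiff e q g) t = 0.
Proof.
case=> _ eN tq; rewrite /kdiff.
(* Extension by zero to all pairs makes the summand alternating. *)
pose F y z := if [&& y \in q :\: t, z \in q :\: t & y != z] then
  e (y |: t) t * x y * (e (z |: (y |: t)) (y |: t) * x z * g (z |: (y |: t))) else 0.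
rewrite (eq_bigr (fun y => \sum_z F y z)); last first.
  move=> y yt; rewrite mulr_sumr big_mkcond; apply: eq_bigr => z _.
  rewrite /F yt /=; congr (if _ then _ else _).
  by rewrite !inE negb_or eq_sym; case: (y == z); rewrite ?andbF //= andbT.
rewrite big_mkcond /= (eq_bigr (fun y => \sum_z F y z)); last first.
  move=> y _; case: ifP => // yt; symmetry; apply: big1 => z _.
  by rewrite /F yt.
apply: sum_alternating => [y|y z]; first by rewrite /F eqxx !andbF.
rewrite /F [z == y]eq_sym; case: (y \in q :\: t) / boolP => yt; last by rewrite andbF addr0.
case: (z \in q :\: t) / boolP => zt; last by rewrite addr0.
case: eqVneq => [//|yz] /=; first by rewrite addr0.
rewrite [y |: (z |: t)]setUCA.
have := eN t y z tq yt zt yz; rewrite [y |: (z |: t)]setUCA.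
set a := e (y |: t) t; set b := e (z |: (y |: t)) (y |: t).
set c := e (z |: t) t; set d := e (z |: (y |: t)) (z |: t).
move=> H; rewrite [a * x y * _]mulrA [c * x z * _]mulrA -mulrDl.
suff -> : a * x y * (b * x z) + c * x z * (d * x y) = (d * c + b * a) * (x y * x z).
  by rewrite H mul0r mul0r.
rewrite mulrDl addrC; congr (_ + _).
  by rewrite mulrACA [x z * x y]mulrC [c * d]mulrC.
by rewrite mulrACA [a * b]mulrC.
Qed.

(** Asked for all subsets rather than for one ordering, so that the induction may remove any
    element. *)
Hypothesis x_regular : forall r y p, y \notin r -> lin_span r (p * x y) -> lin_span r p.

(* Koszul homology of a regular sequence vanishes, whatever the signs:
   induction on #|q|, splitting q = y |: r and the chains on q into those
   containing y and those not containing y. *)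
Lemma koszul_exact e q g : koszul_signs e q ->
  (forall t, t \subset q -> kdiff e q g t = 0) -> lin_span q (g set0) ->
  exists h, forall t, t \subset q -> g t = kdiff e q h t.
Proof.
move: {2}#|q| (erefl #|q|) => N; elim: N q e g => [|N IH] q e g.
  move/eqP; rewrite cards_eq0 => /eqP -> _ _ [c]; rewrite big_set0 => g0.
  by exists (fun=> 0) => t; rewrite subset0 => /eqP ->; rewrite /kdiff set0D big_set0.
move=> cq eq_signs g_cyc [c g0].
have [y yq] : exists y, y \in q by apply/card_gt0P; rewrite cq.
pose r := q :\ y.
have cr : #|r| = N by move: cq; rewrite (cardsD1 y) yq add1n => -[].
have yr : y \notin r by rewrite !inE eqxx.
have rq : r \subset q by apply: subsetDl.
have ytr t : t \subset r -> y \notin t.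
  by move=> tr; apply: contra yr; apply: (subsetP tr).
have y_q t : t \subset r -> y |: t \subset q.
  by move=> tr; rewrite subUset sub1set yq (subset_trans tr).
have qDy t : t \subset r -> q :\: (y |: t) = r :\: t.
  by move=> tr; rewrite /r setDDl.
have qD t : t \subset r -> q :\: t = y |: (r :\: t).
  move=> tr; apply/setP => z; rewrite !inE; case: eqVneq => [->|//] /=.
  by rewrite yq (ytr _ tr).
have kq h t : t \subset r ->
    kdiff e q h t = e (y |: t) t * x y * h (y |: t) + kdiff e r h t.
  by move=> tr; rewrite /kdiff qD // big_setU1 // !inE eqxx andbF.
(* The signs on the sets containing [y], which form a second Koszul complex on [r]. *)
pose e' s t := e (y |: s) (y |: t).
have kqy h t : t \subset r -> kdiff e q h (y |: t) = kdiff e' r (fun s => h (y |: s)) t.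
  move=> tr; rewrite /kdiff qDy //; apply: eq_bigr => z _.
  by rewrite /e' setUCA.
case: (eq_signs) => e1 eN.
have sr : koszul_signs e r.
  split=> [t z tr zt|t z w tr zt wt].
    by apply: e1; rewrite ?(subset_trans tr) ?(subsetP (setSD t rq)).
  by apply: eN; rewrite ?(subset_trans tr) ?(subsetP (setSD t rq)).
have sr' : koszul_signs e' r.
  split=> [t z tr zt|t z w tr zt wt zw]; rewrite /e'.
    by rewrite setUCA; apply: e1; rewrite ?y_q ?qDy.
  rewrite ![y |: (_ |: (_ |: t))]setUCA ![y |: (_ |: t)]setUCA.
  by apply: eN; rewrite ?y_q ?qDy.
have e11 : e [set y] set0 * e [set y] set0 = 1.
  by have := e1 set0 y (sub0set _); rewrite setU0 setD0 expr2; apply.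
have [A' A'E] : exists A', forall t, t \subset r -> g (y |: t) = kdiff e' r A' t.
  apply: (IH r e' (fun s => g (y |: s)) cr sr') => [t tr|].
    by rewrite -kqy // g_cyc // y_q.
  (* The cycle condition at [set0] puts [g [set y] * x y] in the span of [r]. *)
  apply: (x_regular yr); rewrite setU0.
  have := kq g set0 (sub0set _); rewrite g_cyc ?sub0set // setU0 => /esym/eqP.
  rewrite addr_eq0 => /eqP H.
  have -> : g [set y] * x y = e [set y] set0 * (e [set y] set0 * x y * g [set y]).
    by rewrite !mulrA e11 mul1r mulrC.
  rewrite H; exists (fun z => - e [set y] set0 * (e (z |: set0) set0 * g (z |: set0))).
  rewrite mulrN -mulNr /kdiff mulr_sumr setD0; apply: eq_bigr => z _.
  by rewrite -!mulrA [x z * _]mulrC.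
(* The value at [set0] can be chosen freely, as [kdiff] does not read it; this choice cancels the
   [y] term of [g set0] in [h] below. *)
pose A t := if t == set0 then e [set y] set0 * c y else A' t.
have AE t : t \subset r -> g (y |: t) = kdiff e' r A t.
  move=> tr; rewrite A'E //; apply: eq_kdiff => z _.
  by rewrite /A setU_eq0 -[[set z] == _]cards_eq0 cards1.
pose G s := if y \in s then A (s :\ y) else 0.
have Gy t : t \subset r -> G (y |: t) = A t.
  by move=> tr; rewrite /G setU11 setU1K // ytr.
have Gr t z : t \subset r -> z \in r :\: t -> G (z |: t) = 0.
  move=> tr; rewrite !inE => /andP[_ /andP[zy _]].
  by rewrite /G !inE eq_sym (negbTE zy) (negbTE (ytr _ tr)).
have kGr t : t \subset r -> kdiff e r G t = 0.
  by move=> tr; apply: big1 => z zt; rewrite Gr // mulr0.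
(* Subtracting the boundary of [G] kills [g] on the sets containing [y] and leaves a cycle on [r]
   with the signs [e]. *)
pose h t := g t - kdiff e q G t.
have hy t : t \subset r -> h (y |: t) = 0.
  move=> tr; rewrite /h kqy // AE // (_ : kdiff _ _ _ _ = kdiff e' r A t) ?subrr //.
  apply: eq_kdiff => z; rewrite -/(y \in _); move=> zt.
  rewrite Gy // subUset tr andbT sub1set.
  by move: zt; rewrite inE => /andP[].
have [H HE] : exists H, forall t, t \subset r -> h t = kdiff e r H t.
  apply: IH => // [t tr|].
    have := kq h t tr; rewrite hy // mulr0 add0r => <-.
    have tq := subset_trans tr rq.
    by rewrite /h kdiffB g_cyc // kdiff_kdiff // subr0.
  exists c; rewrite /h kq ?sub0set // kGr ?sub0set // Gy ?sub0set // /A eqxx addr0.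
  rewrite g0 (big_setD1 y) //= setU0 -[X in _ - X]mulrA [x y * _]mulrC.
  by rewrite !mulrA e11 mul1r [X in X - _]addrC addrK.
exists (fun s => G s + (if y \in s then 0 else H s)) => t tq.
rewrite kdiffD; case: (boolP (y \in t)) => yt.
  have tr : t :\ y \subset r by apply: setSD.
  rewrite -[t](setD1K yt) [X in _ + X]big1 ?addr0.
    by apply/eqP; rewrite -subr_eq0 -/(h _) hy.
  by move=> z _; rewrite !inE eqxx /= orbT mulr0.
have tr : t \subset r by apply/subsetD1P.
rewrite [X in _ + X]kq // setU11 mulr0 add0r.
rewrite [X in _ = _ + X](_ : _ = h t); first by rewrite /h addrC subrK.
rewrite HE //; apply: eq_kdiff => z; rewrite !inE => /andP[zt /andP[zy _]].
by rewrite eq_sym (negbTE zy) (negbTE yt).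
Qed.

End Koszul.

From mathcomp Require Import boolp classical_sets reals topology.
Import Defs.

(** * Generated ideals and explicit linear combinations *)

Section IdealGen.
Local Open Scope ring_scope.
Local Open Scope classical_set_scope.
Variable S : comNzRingType.

Lemma ideal_gen_ideal (A : set S) : is_ideal (ideal_gen A).
Proof.
split=> [J [[J0 _ _] _] //|p q pA qA J JA|a p pA J JA].
  by case: (JA) => -[_ JD _] _; apply: JD; [apply: pA|apply: qA].
by case: (JA) => -[_ _ JM] _; apply: JM; apply: pA.
Qed.

Lemma ideal_sum (J : set S) (T : Type) (r : seq T) (P : pred T) (F : T -> S) :
  is_ideal J -> (forall i, P i -> J (F i)) -> J (\sum_(i <- r | P i) F i).
Proof. by case=> J0 JD _ JF; apply: (big_ind J). Qed.

Lemma ideal_gen_span (T : finType) (x : T -> S) (r : {set T}) p :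
  ideal_gen [set x i | i in [set` r]] p <-> lin_span x r p.
Proof.
split=> [xp|[c ->]]; last first.
  have [_ _ M] := ideal_gen_ideal [set x i | i in [set` r]].
  apply: ideal_sum; first exact: ideal_gen_ideal.
  by move=> i ir; apply: M; apply: sub_gen_smallest; exists i.
apply: (xp [set p | lin_span x r p]); split; last first.
  move=> _ [i /= ir <-]; exists (fun j => (j == i)%:R).
  rewrite (bigD1 i) //= eqxx mul1r big1 ?addr0 // => j /andP[_ /negbTE->].
  by rewrite mul0r.
split=> [|p1 p2 [c ->] [d ->]|a p1 /lin_spanM]; last exact.
  by exists (fun=> 0); rewrite big1 // => i _; rewrite mul0r.
by exists (fun i => c i + d i); rewrite -big_split; apply: eq_bigr => i _; rewrite mulrDl.
Qed.

End IdealGen.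

(** * Monomial ideals: membership by divisibility *)

Section MonomialIdeals.
Local Open Scope ring_scope.
Local Open Scope classical_set_scope.
Variables (K : fieldType) (n : nat).
Local Notation S := {mpoly K[n]}.
Local Notation mon := 'X_{1..n}.

(** The polynomials satisfying the right-hand side form an ideal containing the generators;
    conversely such a polynomial is a sum of terms lying in the ideal. *)
Lemma monomial_genP (A : set mon) (p : S) :
  monomial_gen A p <-> forall m, m \in msupp p -> exists2 a, A a & (a <= m)%MM.
Proof.
have [I0 ID IM] := @ideal_gen_ideal S [set 'X_[m] | m in A].
split=> [Ap|Ap].
  apply: (Ap [set p : S | forall m, m \in msupp p -> exists2 a, A a & (a <= m)%MM]).
  split; last first.
    by move=> _ [a Aa <-] m; rewrite msuppX inE => /eqP->; exists a; rewrite ?lepm_refl.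
  split=> [m|p1 q1 p1A q1A m|a p1 p1A m]; first by rewrite msupp0.
    by move=> /msuppD_le; rewrite mem_cat => /orP[/p1A|/q1A].
  move=> /msuppM_le /allpairsP[[m1 m2]] /= [_ /p1A[b Ab bm] ->].
  by exists b => //; apply: lepm_trans bm (lem_addl _ _).
rewrite [p]mpolyE big_seq; apply: ideal_sum; first exact: ideal_gen_ideal.
move=> m /Ap[a Aa am]; rewrite -(submK am) mpolyXD scalerAl.
by apply: IM; apply: sub_gen_smallest; exists a.
Qed.

Lemma monomial_genX (A : set mon) m :
  monomial_gen A ('X_[m] : S) <-> exists2 a, A a & (a <= m)%MM.
Proof.
rewrite monomial_genP; split=> [|Am m']; first by apply; rewrite msuppX inE.
by rewrite msuppX inE => /eqP->.
Qed.

Lemma variable_gen_monomial (s : {set 'I_n}) :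
  @variable_gen K n s = monomial_gen [set U_(i)%MM | i in [set` s]].
Proof.
congr ideal_gen; apply/seteqP; split=> [_ [i si <-]|_ [_ [i si <-] <-]].
  by exists U_(i)%MM => //; exists i.
by exists i.
Qed.

Lemma variable_gen_span (s : {set 'I_n}) (p : S) :
  @variable_gen K n s p <-> lin_span (fun i => 'X_i : S) s p.
Proof. exact: ideal_gen_span. Qed.

(** Multiplication by ['X_y] shifts the support by [U_(y)], and a variable other than [y] that
    divides a shifted monomial divides the original one. *)
Lemma variables_regular (r : {set 'I_n}) y (p : S) : y \notin r ->
  lin_span (fun i => 'X_i : S) r (p * 'X_y) -> lin_span (fun i => 'X_i : S) r p.
Proof.
move=> yr; rewrite -!variable_gen_span !variable_gen_monomial !monomial_genP => H m mp.
have /H[_ [i /= ir <-] im] : (U_(y) + m)%MM \in msupp (p * 'X_y).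
  by rewrite (perm_mem (msuppMX _ _)) map_f.
exists U_(i)%MM; first by exists i.
have iy : i != y by apply: contraNneq yr => <-.
apply/mnm_lepP => j; move/mnm_lepP/(_ j): im; rewrite mnmDE !mnm1E.
by case: (i =P j) => // <-; rewrite eq_sym (negbTE iy).
Qed.

Lemma max_idealX (m : mon) : m != 0%MM -> @max_ideal K n 'X_[m].
Proof.
move=> m0; rewrite /max_ideal variable_gen_monomial; apply/monomial_genX.
have [i mi] : exists i, (m i != 0)%N.
  apply: contraNP m0 => /forallNP m0; apply/eqP/mnmP => i.
  by rewrite mnm0E; apply/eqP; have /negP := m0 i; rewrite negbK.
exists U_(i)%MM; first by exists i; rewrite //= inE.
by rewrite lep1mP.
Qed.

End MonomialIdeals.

(** * The decomposition function of an admissible order *)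

Section Decomposition.
Local Open Scope ring_scope.
Local Open Scope classical_set_scope.
Variables (K : fieldType) (n : nat) (I : set {mpoly K[n]}).
Variables (u : seq 'X_{1..n}) (q : 'X_{1..n} -> {set 'I_n}).
Hypothesis u_adm : admissible I u q.
Local Notation "u_[ j ]" := (nth 0%MM u j) (at level 0, format "u_[ j ]").
Implicit Types (s t : {set 'I_n}) (m w : 'X_{1..n}).

Local Notation sqfree s := (\sum_(y in s) U_(y))%MM.

Lemma sqfreeE s i : (sqfree s) i = (i \in s).
Proof.
rewrite mnm_sumE; under eq_bigr do rewrite mnm1E.
case: (boolP (i \in s)) => si.
  by rewrite (bigD1 i) //= eqxx big1 // => j /andP[_ /negbTE->].
by rewrite big1 // => j js; case: eqP => // ji; rewrite -ji js in si.
Qed.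

Lemma initial_idealX j m : (j <= size u)%N ->
  initial_ideal u j ('X_[m] : {mpoly K[n]}) <-> exists2 i, (i < j)%N & (u_[i] <= m)%MM.
Proof.
move=> ju; rewrite /initial_ideal monomial_genX; split=> [[a /= ainu am]|[i ij im]].
  move/(nthP 0%MM): ainu => -[i]; rewrite size_takel // => ij ia.
  by exists i => //; rewrite -(nth_take 0%MM ij) ia.
exists u_[i] => //=; rewrite -(nth_take 0%MM ij).
by apply: mem_nth; rewrite size_takel.
Qed.

Lemma mem_u j : (j < size u)%N -> u_[j] \in u.
Proof. exact: mem_nth. Qed.

(** If u_i divided a different u_j, dropping u_j would leave a generating set, against
    minimality. *)
Lemma gens_antichain i j : (i < size u)%N -> (j < size u)%N ->
  (u_[i] <= u_[j])%MM -> i = j.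
Proof.
case: u_adm => u_uniq [uI u_min] _ _ iu ju le_ij; apply/eqP; apply: contraT => ij.
have neq : u_[i] != u_[j] by rewrite nth_uniq.
suff E : [set` u] `\ u_[j] = [set` u].
  have : ([set` u] `\ u_[j]) u_[j] by rewrite E; apply: mem_u.
  by case=> _; case.
apply: u_min => [m []//|]; rewrite -uI; apply/seteqP; split=> p /monomial_genP H;
  apply/monomial_genP => m /H [a].
  by case=> au _ am; exists a.
move=> /= au am; have [aj|/eqP aj] := eqVneq a u_[j]; last by exists a.
exists u_[i]; last by apply: lepm_trans le_ij _; rewrite -aj.
by split; [exact: mem_u|exact/eqP].
Qed.

(** At the first initial ideal that contains [m], the generator dividing [m] cannot be an earlier
    one, so it is the last one added. *)
Lemma decomp_spec j m : (j < size u)%N -> (u_[j] <= m)%MM ->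
  exists i, [/\ (i <= j)%N, decomp K u m = u_[i] & (u_[i] <= m)%MM].
Proof.
move=> ju jm; pose P i := `[< initial_ideal u i.+1 ('X_[m] : {mpoly K[n]}) >].
have Pj : P j by apply/asboolP/initial_idealX => //; exists j.
have hasP : has P (iota 0 (size u)) by apply/hasP; exists j; rewrite // mem_iota.
pose i := find P (iota 0 (size u)).
have iu : (i < size u)%N by rewrite -[X in (_ < X)%N](size_iota 0) -has_find.
have Pi : P i by have := nth_find 0 hasP; rewrite nth_iota.
have minP k : (k < i)%N -> P k = false.
  by move=> ki; rewrite -(before_find 0 ki) nth_iota // (ltn_trans ki).
exists i; split=> //; first by rewrite leqNgt; apply/negP => /minP; rewrite Pj.
move/asboolP/(initial_idealX _ iu): Pi => -[k]; rewrite ltnS leq_eqVlt.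
case/orP=> [/eqP-> //|ki km]; have := minP k ki; move/negP; case.
by apply/asboolP/initial_idealX; [exact: ltn_trans iu|exists k].
Qed.

Lemma colon_var j y : (j < size u)%N -> y \in q u_[j] ->
  exists2 i, (i < j)%N & (u_[i] <= U_(y) + u_[j])%MM.
Proof.
case: u_adm => _ _ _ colonE ju yq.
apply/(initial_idealX _ (ltnW ju)); rewrite mpolyXD.
suff : colon (initial_ideal u j) 'X_[u_[j]] ('X_y : {mpoly K[n]}) by [].
by rewrite colonE //; apply: sub_gen_smallest; exists y.
Qed.

(** A single variable of [s] already moves u_j into the ideal of the earlier generators, so the
    decomposition function picks an index below [j]. *)
Lemma decomp_at_spec j s : (j < size u)%N -> s \subset q u_[j] -> s != finset.set0 ->
  exists i, [/\ (i < j)%N, decomp_at K u s u_[j] = u_[i]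
                & (u_[i] <= u_[j] + sqfree s)%MM].
Proof.
move=> ju sq /finset.set0Pn[y ys]; have [k kj km] := colon_var ju (fintype.subsetP sq y ys).
have ks : (u_[k] <= u_[j] + sqfree s)%MM.
  apply: lepm_trans km _; rewrite addmC; apply/mnm_lepP => i.
  by rewrite !mnmDE sqfreeE mnm1E leq_add2l; case: eqP => // <-; rewrite ys.
have [i [ik decompE im]] := decomp_spec (ltn_trans kj ju) ks.
by exists i; split=> //; apply: leq_ltn_trans ik kj.
Qed.

(** This earlier generator divides y u_j but, by [gens_antichain], not u_j; only the exponent of [y]
    can make the difference. *)
Lemma decomp_at1 j y : (j < size u)%N -> y \in q u_[j] ->
  (u_[j] y < decomp_at K u [set y]%SET u_[j] y)%N.
Proof.
move=> ju yq.
have [||i [ij -> im]] := @decomp_at_spec j [set y]%SET ju.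
- by rewrite finset.sub1set.
- by apply/finset.set0Pn; exists y; rewrite inE.
have iu := ltn_trans ij ju.
rewrite ltnNge; apply/negP => le_y; suff ji : i = j by rewrite ji ltnn in ij.
apply: gens_antichain => //; apply/mnm_lepP => k.
have [->//|ky] := eqVneq k y; move/mnm_lepP/(_ k): im.
by rewrite mnmDE sqfreeE inE (negbTE ky) addn0.
Qed.

End Decomposition.

(** * Vertices as points of the space *)

Section Points.
Local Open Scope ring_scope.
Local Open Scope classical_set_scope.
Variables (R : realType) (X : regular_cell_complex R).

(** In dimension zero the open and the closed ball are the same single point. *)
Lemma vertex_point (v : cell X) : dim v = 0%N ->
  exists p, ocell v = [set p] /\ ccell v = [set p].
Proof.
move=> v0; have [f [_ _ fc fo]] := cell_ball v.
have all_eq (a b : 'rV[R]_(dim v)) : a = b.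
  by apply/rowP => -[i lti]; exfalso; rewrite v0 in lti.
have E (D : set 'rV[R]_(dim v)) : D 0 -> f @` D = [set f 0].
  move=> D0; apply/seteqP; split=> [_ [a _ <-] /=|_ ->]; last by exists 0.
  by rewrite (all_eq a 0).
have S0 : \sum_(i < dim v) (0 : 'rV[R]_(dim v)) ord0 i ^+ 2 = 0.
  by apply: big1 => i _; rewrite mxE expr0n.
exists (f 0); split; first by rewrite -fo E // /open_unit_ball /= S0 ltr01.
by rewrite /ccell -fc E // /closed_unit_ball /= S0 ler01.
Qed.

Lemma ocell_inj (c c' : cell X) p : ocell c p -> ocell c' p -> c = c'.
Proof. by move=> cp cp'; apply: (@cell_disjoint _ X c c') => //; exists p. Qed.

Lemma ocell_sub (c : cell X) : ocell c `<=` ccell c.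
Proof. exact: subset_closure. Qed.

Lemma vertex_in_cell (v c : cell X) p : dim v = 0%N -> ocell v p -> ccell c p ->
  vertex_of v c.
Proof.
move=> v0 vp cp; split=> //; have [p' [voE vcE]] := vertex_point v0.
by move: vp; rewrite voE /= => pp'; rewrite /face vcE => _ ->; rewrite -pp'.
Qed.

Lemma vertex_of_vertex (v w : cell X) : dim w = 0%N -> vertex_of v w -> v = w.
Proof.
move=> w0 [v0 vw]; have [p [vo _]] := vertex_point v0.
have [p' [wo wc]] := vertex_point w0.
have vp : ocell v p by rewrite vo.
have := vw p (ocell_sub vp); rewrite wc => /= pp'.
by apply: (@ocell_inj v w p); rewrite // wo.
Qed.

End Points.

Lemma big_mlcm_le (n : nat) (T : eqType) (r : seq T) (P : pred T) (F : T -> 'X_{1..n}) m :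
  (\big[@mlcm n/0%MM]_(i <- r | P i) F i <= m)%MM
  = all (fun i => P i ==> (F i <= m)%MM) r.
Proof.
elim: r => [|i r IH]; first by rewrite big_nil; apply/mnm_lepP => i; rewrite mnm0E.
by rewrite big_cons /=; case: (P i); rewrite ?lem_mlcm IH.
Qed.

(** * Vertices, faces and labels of the cells B(s, u_j) *)

Section Labels.
Local Open Scope ring_scope.
Local Open Scope classical_set_scope.
Variables (K : fieldType) (n : nat) (I : set {mpoly K[n]}).
Variables (u : seq 'X_{1..n}) (q : 'X_{1..n} -> {set 'I_n}).
Variables (R : realType) (X : regular_cell_complex R).
Variables (B : {set 'I_n} -> 'X_{1..n} -> cell X) (lab : cell X -> 'X_{1..n}).
Hypothesis u_adm : admissible I u q.
Hypothesis X_I : is_X_I K u q B.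
Hypothesis lab_vertex : forall w, w \in u -> lab (B finset.set0 w) = w.
Local Notation "u_[ j ]" := (nth 0%MM u j) (at level 0, format "u_[ j ]").
Local Notation sqfree s := (\sum_(y in s) U_(y))%MM.
Implicit Types (s t : {set 'I_n}) (m w : 'X_{1..n}) (c v : cell X).

Lemma stageS j c : (j < size u)%N ->
  stage u q B j.+1 c <->
  stage u q B j c \/ exists2 s : {set 'I_n}, s \subset q u_[j] & c = B s u_[j].
Proof.
move=> ju; split=> [[i [s [ij iu sq cE]]]|[[i [s [ij iu sq cE]]]|[s sq cE]]].
- move: ij; rewrite ltnS leq_eqVlt => /orP[/eqP ij|ij]; last by left; exists i, s.
  by right; rewrite -ij; exists s.
- by exists i, s; split=> //; apply: ltnW.
- by exists j, s.
Qed.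

Lemma stage_top j s : (j < size u)%N -> s \subset q u_[j] -> ~ stage u q B j (B s u_[j]).
Proof.
move=> ju sq [i [t [ij iu tq]]].
case/(XI_distinct X_I (mem_u ju) (mem_u iu) sq tq) => /eqP.
by case: u_adm => u_uniq _ _ _; rewrite nth_uniq // => /eqP ji; rewrite ji ltnn in ij.
Qed.

Lemma stage_vertex j c : stage u q B j c -> dim c = 0%N ->
  exists i, [/\ (i < j)%N, (i < size u)%N & c = B finset.set0 u_[i]].
Proof.
move=> [i [s [ij iu sq ->]]]; rewrite (XI_dim X_I) ?mem_u // => /cards0_eq ->.
by exists i.
Qed.

Lemma dim_vertex w : w \in u -> dim (B finset.set0 w) = 0%N.
Proof. by move=> wu; rewrite (XI_dim X_I) ?finset.sub0set ?cards0. Qed.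

Lemma base_mono j s t : t \subset s -> base K u q B j t `<=` base K u q B j s.
Proof.
move=> ts c [cj cV]; split=> // v /cV [t' [t'0 t't] <-].
by exists t' => //; split=> //; apply: fintype.subset_trans ts.
Qed.

Lemma base_cell j s c : (j < size u)%N -> s \proper q u_[j] ->
  base K u q B j s c -> face c (B s u_[j]).
Proof.
move=> ju sq cs; have [a [h [_ _ [_ h01 _ _ _] coneE]]] := XI_proper X_I ju.
rewrite /face coneE // => p cp; right.
have Lp : Defs.support (base K u q B j s) p by exists c.
have Lp' : base_boundary K u q B j p by exists s.
(* The base of the cone is its slice at parameter 0. *)
by have [h0 _] := h01 p Lp'; exists (p, 0); rewrite //= in_itv /= lexx ler01.
Qed.

(** The cones of one stage share apex and cone map, so inclusion of bases gives inclusion of cones;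
    the top cell has all of them in its boundary. *)
Lemma face_B j s t : (j < size u)%N -> s \subset q u_[j] -> t \subset s ->
  face (B t u_[j]) (B s u_[j]).
Proof.
move=> ju sq ts; have [->//|t_s] := eqVneq t s.
have tq : t \proper q u_[j].
  by apply: proper_sub_trans sq; rewrite finset.properEneq t_s.
have [sq'|] := eqVneq s (q u_[j]).
  rewrite sq' => p tp; have : (ccell (B (q u_[j]) u_[j]) `\` ocell (B (q u_[j]) u_[j])) p.
    by rewrite (XI_top X_I ju); right; exists t.
  by case.
move=> s_q; have sq' : s \proper q u_[j] by rewrite finset.properEneq s_q.
have [a [h [_ _ _ coneE]]] := XI_proper X_I ju.
rewrite /face !coneE // => p [->|[[p' r] [/= [c ct cp] r01] <-]]; first by left.
by right; exists (p', r) => //; split=> //; exists c => //; apply: base_mono ct.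
Qed.

Lemma base_face_B j s c : (j < size u)%N -> s \subset q u_[j] ->
  base K u q B j s c -> face c (B s u_[j]).
Proof.
move=> ju sq cs; have [sq'|s_q] := eqVneq s (q u_[j]); last first.
  by apply: base_cell; rewrite // finset.properEneq s_q.
rewrite sq' in cs * => p cp.
have : (ccell (B (q u_[j]) u_[j]) `\` ocell (B (q u_[j]) u_[j])) p.
  by rewrite (XI_top X_I ju); left; exists c.
by case.
Qed.

(** A vertex other than u_j belongs to the previous stage, which the cone meets only in its base.
    There it is a vertex of an induced cell, hence some g(t; u_j). *)
Lemma vertex_B j s v : (j < size u)%N -> s \subset q u_[j] ->
  vertex_of v (B s u_[j]) <->
  v = B finset.set0 u_[j] \/
  exists t, [/\ t != finset.set0, t \subset s
              & v = B finset.set0 (decomp_at K u t u_[j])].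
Proof.
move=> ju sq; split; last first.
  case=> [->|[t [t0 ts ->]]].
    by split; [exact/dim_vertex/mem_u|exact: face_B (finset.sub0set _)].
  have [i [ij gE _]] := decomp_at_spec u_adm ju (fintype.subset_trans ts sq) t0.
  have iu := ltn_trans ij ju.
  split; first by rewrite gE; apply/dim_vertex/mem_u.
  apply: base_face_B => //; split.
    by rewrite gE; exists i, finset.set0; rewrite finset.sub0set.
  move=> w; rewrite gE => /(vertex_of_vertex (dim_vertex (mem_u iu))) ->.
  by exists t => //; rewrite gE.
case=> v0 vs; have Bj : stage u q B j.+1 (B s u_[j]) by exists j, s.
have [i [ij iu vE]] := stage_vertex (XI_stage X_I ju Bj vs) v0.
move: ij; rewrite ltnS leq_eqVlt => /orP[/eqP ij|ij]; first by left; rewrite vE ij.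
right; have [p [vo vc]] := vertex_point v0.
have vp : ocell v p by rewrite vo.
have Yp : Defs.support (stage u q B j) p.
  by exists v; [rewrite vE; exists i, finset.set0; rewrite finset.sub0set|exact: ocell_sub].
have baseP s' : s' \subset s -> Defs.support (base K u q B j s') p ->
    exists t, [/\ t != finset.set0, t \subset s
              & v = B finset.set0 (decomp_at K u t u_[j])].
  move=> s's [c [_ cV] cp]; have [t [t0 ts'] <-] := cV v (vertex_in_cell v0 vp cp).
  by exists t; split=> //; apply: fintype.subset_trans s's.
have [a [h [aE aY [_ h01 _ _ hY] coneE]]] := XI_proper X_I ju.
have coneP s' : s' \subset s -> s' \proper q u_[j] -> ccell (B s' u_[j]) p ->
    exists t, [/\ t != finset.set0, t \subset s
              & v = B finset.set0 (decomp_at K u t u_[j])].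
  move=> s's s'q; rewrite coneE // => -[pa|]; first by case: aY; rewrite -pa.
  move=> [[p' r] [/= Lp']]; rewrite in_itv /= => /andP[r0 r1] hp.
  have Lp : base_boundary K u q B j p' by exists s'.
  (* Positive parameters lead outside the previous stage. *)
  have r00 : r = 0.
    have [//|r_neq0] := eqVneq r 0; case: (hY p' r Lp); rewrite ?hp //.
    by rewrite lt_def r_neq0 r0 r1.
  by apply: (baseP s') => //; rewrite -hp r00 (h01 p' Lp).1.
have Bp : ccell (B s u_[j]) p by apply: vs; apply: ocell_sub.
have [sq'|s_q] := eqVneq s (q u_[j]); last first.
  by apply: (coneP s) => //; rewrite finset.properEneq s_q.
(* The point is not in the open top cell, since [v] would then be that cell, so [XI_top] locates
   it. *)
have : (ccell (B (q u_[j]) u_[j]) `\` ocell (B (q u_[j]) u_[j])) p.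
  split; rewrite -sq' // => Bo; have vB := ocell_inj vp Bo.
  case: (stage_top ju sq); rewrite -vB vE.
  by exists i, finset.set0; rewrite finset.sub0set.
rewrite (XI_top X_I ju) => -[|[s' s'q]].
  by apply: baseP; rewrite sq'.
by apply: coneP; rewrite // sq' fintype.proper_sub.
Qed.

Lemma dvd_alabel c m :
  (alabel lab (Some c) <= m)%MM <-> forall v, vertex_of v c -> (lab v <= m)%MM.
Proof.
rewrite /alabel big_mlcm_le; split=> [/allP cm v vc|vm].
  by have := cm v (mem_index_enum v); move/implyP; apply; apply/asboolP.
by apply/allP => v _; apply/implyP => /asboolP/vm.
Qed.

Lemma alabel_face (c c' : acell X) : aface c' c -> (alabel lab c' <= alabel lab c)%MM.
Proof.
case: c' => [c'|_]; last by apply/mnm_lepP => i; rewrite mnm0E.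
case: c => [c|//] c'c; apply/dvd_alabel => v [v0 vc'].
have /dvd_alabel := lepm_refl (alabel lab (Some c)).
by apply; split=> //; apply: subset_trans c'c.
Qed.

(** Every vertex divides the right-hand side by [decomp_at_spec]. Each exponent is attained: by u_j
    outside [s], and at [y] in [s] by g({y}; u_j), thanks to [decomp_at1]. *)
Lemma alabel_B j s : (j < size u)%N -> s \subset q u_[j] ->
  alabel lab (Some (B s u_[j])) = (u_[j] + sqfree s)%MM.
Proof.
move=> ju sq; apply/mnmP => y; apply/eqP; rewrite eqn_leq; apply/andP; split.
  apply/mnm_lepP: y; apply/dvd_alabel => v /(vertex_B _ ju sq)[->|[t [t0 ts ->]]].
    by rewrite lab_vertex ?mem_u // lem_addr.
  have [i [ij gE im]] := decomp_at_spec u_adm ju (fintype.subset_trans ts sq) t0.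
  rewrite gE lab_vertex ?mem_u ?(ltn_trans ij) //; apply: lepm_trans im _.
  apply/mnm_lepP => k; rewrite !mnmDE !sqfreeE leq_add2l.
  by case: (boolP (k \in t)) => // /(fintype.subsetP ts) ->.
have vB v : vertex_of v (B s u_[j]) -> (lab v y <= alabel lab (Some (B s u_[j])) y)%N.
  move=> vs; apply/mnm_lepP: y.
  by have /dvd_alabel := lepm_refl (alabel lab (Some (B s u_[j]))); apply.
rewrite mnmDE sqfreeE; case: (boolP (y \in s)) => ys; last first.
  by rewrite addn0 -{1}(lab_vertex (mem_u ju)) vB //; apply/vertex_B => //; left.
have yq := fintype.subsetP sq y ys.
have y0 : [set y]%SET != finset.set0 by apply/finset.set0Pn; exists y; rewrite inE.
rewrite addn1; apply: leq_trans (decomp_at1 u_adm ju yq) _.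
have [|i [ij gE _]] := decomp_at_spec u_adm ju _ y0; first by rewrite finset.sub1set.
rewrite gE -(lab_vertex (mem_u (ltn_trans ij ju))) vB // -gE.
by apply/vertex_B => //; right; exists [set y]%SET; rewrite finset.sub1set.
Qed.

(** Labels divide along faces, and for fixed [j] the label of B(s, u_j) recovers [s]. *)
Lemma face_BP j s t : (j < size u)%N -> s \subset q u_[j] -> t \subset q u_[j] ->
  face (B t u_[j]) (B s u_[j]) <-> t \subset s.
Proof.
move=> ju sq tq; split; last exact: face_B.
move=> ts; have : aface (Some (B t u_[j])) (Some (B s u_[j])) by [].
move=> /alabel_face; rewrite !alabel_B // => /mnm_lepP le_ts.
apply/fintype.subsetP => y yt; have := le_ts y.
by rewrite !mnmDE !sqfreeE yt leq_add2l; case: (y \in s).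
Qed.

(* The generators appear in increasing degree, so the degree of the label drops
   when passing to a facet. *)
Lemma alabel_facet_neq (c c' : cell X) : face c' c -> dim c = (dim c').+1 ->
  alabel lab (Some c') != alabel lab (Some c).
Proof.
have [j [s [ju _ sq ->]]] := XI_cells X_I c.
move=> c's dimE; have Bj : stage u q B j.+1 (B s u_[j]) by exists j, s.
have [i [t [ij iu tq c'E]]] := XI_stage X_I ju Bj c's.
rewrite c'E in dimE *; apply/eqP; rewrite !alabel_B // => /(congr1 mdeg).
have mdeg_sq (r : {set 'I_n}) : mdeg (sqfree r) = #|r|.
  by rewrite mdeg_sum -sum1_card; apply: eq_bigr => k _; rewrite mdeg1.
rewrite !mdegD !mdeg_sq; move: dimE; rewrite !(XI_dim X_I) ?mem_u // => ->.
have le_deg : (mdeg u_[i] <= mdeg u_[j])%N.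
  case: u_adm => _ _ u_deg _.
  have := sorted_leq_nth leq_trans leqnn 0%N u_deg i j.
  rewrite !inE !size_map !(nth_map 0%MM) // => -> //.
move/eqP; rewrite addnS; apply/negP; rewrite neq_ltn ltnS leq_add2r le_deg //.
Qed.

End Labels.

(** * Reindexing of finite sums *)

Section Sums.
Local Open Scope ring_scope.
Variables (V : nmodType) (T : finType).

Lemma sum_sig (Q : pred T) (F : T -> V) : (forall c, ~~ Q c -> F c = 0) ->
  \sum_(c : {c : T | Q c}) F (val c) = \sum_c F c.
Proof.
move=> FQ; rewrite [RHS](bigID Q) /= [X in _ + X]big1 // addr0.
rewrite [RHS](reindex_omap (val : {c : T | Q c} -> T) insub); last first.
  by move=> c Qc; rewrite insubT.
by apply: eq_bigl => c; rewrite (valP c) valK eqxx.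
Qed.

Lemma sum_image (U : finType) (A : {set U}) (h : U -> T) (F : T -> V) :
  {in A &, injective h} -> (forall c, F c != 0 -> exists2 y, y \in A & c = h y) ->
  \sum_c F c = \sum_(y in A) F (h y).
Proof.
move=> h_inj FA; rewrite -(big_imset F h_inj) [RHS]big_mkcond; apply: eq_bigr => c _.
case: ifP => // /negP cA; apply/eqP; apply: contraT => /FA[y yA cE]; case: cA.
by rewrite cE imset_f.
Qed.

End Sums.

(** * The boundary on all cells and its exactness *)

Section Resolution.
Local Open Scope ring_scope.
Local Open Scope classical_set_scope.
Variables (K : fieldType) (n : nat) (I : set {mpoly K[n]}).
Variables (u : seq 'X_{1..n}) (q : 'X_{1..n} -> {set 'I_n}).
Variables (R : realType) (X : regular_cell_complex R).
Variables (B : {set 'I_n} -> 'X_{1..n} -> cell X) (lab : cell X -> 'X_{1..n}).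
Hypothesis u_adm : admissible I u q.
Hypothesis X_I : is_X_I K u q B.
Hypothesis lab_vertex : forall w, w \in u -> lab (B finset.set0 w) = w.
Variable eps : acell X -> acell X -> int.
Hypothesis eps_inc : incidence eps.
Local Notation S := {mpoly K[n]}.
Local Notation "u_[ j ]" := (nth 0%MM u j) (at level 0, format "u_[ j ]").
Local Notation sqfree s := (\sum_(y in s) U_(y))%MM.
Implicit Types (s t : {set 'I_n}) (c : acell X) (f g h : acell X -> S).

(* All homological degrees are treated at once: a chain is a function on the
   set of all cells, the empty one included. *)
Definition bdmx c c' : S :=
  if hdeg c == (hdeg c').+1 then (eps c c')%:~R * 'X_[(alabel lab c - alabel lab c')%MM]
  else 0.

Definition bd f c' : S := \sum_c f c * bdmx c c'.

Lemma bdmx_neq0 c c' : bdmx c c' != 0 -> hdeg c = (hdeg c').+1 /\ aface c' c.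
Proof.
rewrite /bdmx; case: ifP => [/eqP deg|_]; last by rewrite eqxx.
move=> epsX; split=> //; apply: contrapT => nface.
by move: epsX; rewrite (incidence_nonface eps_inc deg nface) mul0r eqxx.
Qed.

(** Along faces the quotients of labels multiply to one that is independent of the middle cell, so
    [incidence_square] applies; off faces the incidence numbers vanish. *)
Lemma bdmx_bdmx c c'' : \sum_c' bdmx c c' * bdmx c' c'' = 0.
Proof.
have [deg|deg] := eqVneq (hdeg c) (hdeg c'').+2; last first.
  apply: big1 => c' _; rewrite /bdmx; case: eqP => [E|_]; last by rewrite mul0r.
  by case: eqP => [E'|_]; [case/eqP: deg; rewrite E E'|rewrite mulr0].
transitivity (\sum_(c' | hdeg c' == (hdeg c'').+1)
    (eps c c' * eps c' c'')%:~R * ('X_[(alabel lab c - alabel lab c'')%MM] : S)).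
  rewrite [RHS]big_mkcond; apply: eq_bigr => c' _.
  rewrite /bdmx; case: eqP => [E|NE]; last first.
    by rewrite mul0r; case: eqP => // E'; rewrite deg E' in NE.
  have E' : hdeg c' = (hdeg c'').+1 by apply: succn_inj; rewrite -E.
  rewrite E' eqxx mulrACA -mpolyXD -rmorphM.
  have [f1|nf] := pselect (aface c' c); last first.
    by rewrite (incidence_nonface eps_inc E nf) mul0r !mul0r.
  have [f2|nf] := pselect (aface c'' c'); last first.
    by rewrite (incidence_nonface eps_inc E' nf) mulr0 !mul0r.
  (* Divisibility of the labels makes the truncated subtraction of exponents exact. *)
  have /mnm_lepP l1 := alabel_face lab f1; have /mnm_lepP l2 := alabel_face lab f2.
  congr (_ * 'X_[_]); apply/mnmP => i; rewrite mnmDE !mnmBE.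
  by rewrite addnBA // subnK.
by rewrite -mulr_suml -rmorph_sum (incidence_square eps_inc deg) mul0r.
Qed.

Lemma bd_bd f c : bd (bd f) c = 0.
Proof.
rewrite /bd; under eq_bigr do rewrite mulr_suml; rewrite exchange_big /= big1 // => d _.
by under eq_bigr do rewrite -mulrA; rewrite -mulr_sumr bdmx_bdmx mulr0.
Qed.

Lemma bdB f g c : bd (fun d => f d - g d) c = bd f c - bd g c.
Proof. by rewrite -sumrB; apply: eq_bigr => d _; rewrite mulrBl. Qed.

Lemma bdD f g c : bd (fun d => f d + g d) c = bd f c + bd g c.
Proof. by rewrite -big_split; apply: eq_bigr => d _; rewrite mulrDl. Qed.

(** The coefficient at the empty cell is left free. *)
Definition supported j f := forall c : cell X, ~ stage u q B j c -> f (Some c) = 0.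

Lemma bd_supported j f : (j <= size u)%N -> supported j f -> supported j (bd f).
Proof.
move=> ju fj c cj; apply: big1 => -[d|] _; last by rewrite /bdmx mulr0.
have [dj|dj] := pselect (stage u q B j d); last by rewrite fj ?mul0r.
have [->|/bdmx_neq0[_ cd]] := eqVneq (bdmx (Some d) (Some c)) 0; first by rewrite mulr0.
by case: cj; exact: (XI_stage X_I ju dj cd).
Qed.

Lemma bdmx_vertex i : (i < size u)%N -> bdmx (Some (B finset.set0 u_[i])) None = 'X_[u_[i]].
Proof.
move=> iu; have d0 := dim_vertex X_I (mem_u iu).
rewrite /bdmx.
have -> : hdeg (Some (B finset.set0 u_[i])) == (hdeg None).+1 by rewrite /= d0.
rewrite (incidence_empty eps_inc) // mul1r; congr 'X_[_].
apply/mnmP => k; rewrite mnmBE [X in (_ - X)%N]mnm0E subn0.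
by rewrite (alabel_B u_adm X_I lab_vertex iu) ?finset.sub0set // mnmDE sqfreeE inE addn0.
Qed.

(** The predicate [P] allows the newest vertex to be split off, so that the remaining sum falls in
    the ideal of the earlier generators. *)
Lemma bd_initial_ideal j f (P : pred (acell X)) : (j <= size u)%N ->
  (forall c : cell X, P (Some c) -> dim c = 0%N -> ~ stage u q B j c -> f (Some c) = 0) ->
  initial_ideal u j (\sum_(c | P c) f c * bdmx c None).
Proof.
move=> ju fP; have IJ : is_ideal (initial_ideal u j : set S) by apply: ideal_gen_ideal.
apply: (ideal_sum _ IJ) => -[c|] Pc; last first.
  by rewrite /bdmx mulr0; case: IJ.
have [I0 _ IM] := IJ.
have [->|/bdmx_neq0[/= [c0] _]] := eqVneq (bdmx (Some c) None) 0; first by rewrite mulr0.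
have [cj|cj] := pselect (stage u q B j c); last by rewrite fP // mul0r.
have [i [ij iu ->]] := stage_vertex X_I cj c0.
by apply: IM; rewrite bdmx_vertex //; apply/initial_idealX => //; exists i; rewrite ?lepm_refl.
Qed.

(** * One stage: the cells added with u_j form a Koszul complex *)

Section Step.
Variable j : nat.
Hypothesis ju : (j < size u)%N.
Local Notation q_j := (q u_[j]).
Local Notation Bj s := (B s u_[j]).

Definition kos_sign s t : S := (eps (Some (Bj s)) (Some (Bj t)))%:~R.

Lemma hdeg_B s : s \subset q_j -> hdeg (Some (Bj s)) = #|s|.+1.
Proof. by move=> sq; rewrite /= (XI_dim X_I) ?mem_u. Qed.

Lemma Bj_inj s t : s \subset q_j -> t \subset q_j -> Bj s = Bj t -> s = t.
Proof. by move=> sq tq /(XI_distinct X_I (mem_u ju) (mem_u ju) sq tq) []. Qed.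

Lemma subset_U1 t y : t \subset q_j -> y \in (q_j :\: t)%SET -> y |: t \subset q_j.
Proof. by move=> tq; rewrite inE => /andP[_ yq]; rewrite finset.subUset finset.sub1set yq. Qed.

Lemma hdeg_B1 t y : t \subset q_j -> y \in (q_j :\: t)%SET ->
  hdeg (Some (Bj (y |: t))) = (hdeg (Some (Bj t))).+1.
Proof.
move=> tq yt; rewrite !hdeg_B ?subset_U1 //.
by move: yt; rewrite inE cardsU1 => /andP[-> _].
Qed.

(** Earlier stages are closed under faces, so none of their cells contains [Bj t]; a new cell [Bj s]
    that does has exactly one element more in [s]. *)
Lemma cofacet_B t c : t \subset q_j -> (forall d, c = Some d -> stage u q B j.+1 d) ->
  hdeg c = (hdeg (Some (Bj t))).+1 -> aface (Some (Bj t)) c ->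
  exists2 y, y \in (q_j :\: t)%SET & c = Some (Bj (y |: t)).
Proof.
case: c => [d|_ _ //] tq /(_ d erefl) /(stageS _ _ _ ju) [dj|[s sq ->]] deg ft.
  by case: (stage_top u_adm X_I ju tq); exact: (XI_stage X_I (ltnW ju) dj ft).
have ts : t \subset s by apply/(face_BP u_adm X_I lab_vertex ju sq tq).
move: deg; rewrite !hdeg_B // => -[sE].
have : #|(s :\: t)%SET| == 1%N by rewrite cardsD (finset.setIidPr ts) sE subSnn.
case/cards1P => y sty; exists y.
  have : y \in (s :\: t)%SET by rewrite sty inE.
  by rewrite !inE => /andP[-> /(fintype.subsetP sq)].
by rewrite -[s](finset.setID s t) (finset.setIidPr ts) sty finset.setUC.
Qed.

(** Only two middle cells contribute between [Bj t] and [Bj (y |: (z |: t))], so [incidence_square]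
    becomes the two-term relation. *)
Lemma kos_signsP : koszul_signs kos_sign q_j.
Proof.
split=> [t y tq yt|t y z tq yt zt yz].
  have deg := hdeg_B1 tq yt; rewrite /kos_sign.
  have ft : aface (Some (Bj t)) (Some (Bj (y |: t))).
    by apply: (face_B X_I ju); rewrite ?subset_U1 // finset.subsetUr.
  by case: (incidence_face eps_inc deg ft) => ->; rewrite ?mulrN1z ?sqrrN expr1n.
have yzt : y \in (q_j :\: (z |: t))%SET.
  by move: yt; rewrite !inE negb_or yz => /andP[-> ->].
have zyt : z \in (q_j :\: (y |: t))%SET.
  by move: zt; rewrite !inE negb_or eq_sym yz => /andP[-> ->].
have ztq := subset_U1 tq zt; have ytq := subset_U1 tq yt.
have deg : hdeg (Some (Bj (y |: (z |: t)))) = (hdeg (Some (Bj t))).+2.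
  by rewrite hdeg_B1 // hdeg_B1.
have /(congr1 (fun k : int => k%:~R : S)) := incidence_square eps_inc deg.
have neq : Some (Bj (y |: t)) != Some (Bj (z |: t)).
  apply/eqP => -[/(Bj_inj ytq ztq)] /finset.setP/(_ y).
  by move: yt; rewrite !inE eqxx (negbTE yz) => /andP[/negbTE->].
rewrite (bigD1 (Some (Bj (z |: t)))) ?hdeg_B1 //=.
rewrite (bigD1 (Some (Bj (y |: t)))) /= ?neq ?andbT; last first.
  by apply/eqP; apply: (hdeg_B1 tq yt).
rewrite big1 ?addr0; last first.
  move=> c /andP[/andP[/eqP degc cz] cy].
  have [fc|nf] := pselect (aface c (Some (Bj (y |: (z |: t))))); last first.
    by rewrite (incidence_nonface eps_inc) ?mul0r // deg degc.
  have [ft|nf] := pselect (aface (Some (Bj t)) c); last first.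
    by rewrite [X in _ * X](incidence_nonface eps_inc) ?mulr0.
  (* A middle cell is some [Bj (x |: t)], and being a face of the larger cell forces [x] to be [y]
     or [z]. *)
  have [d dE|x xt cE] := cofacet_B tq _ degc ft.
    rewrite dE in fc; apply: (XI_stage X_I ju (c := Bj (y |: (z |: t))) _ fc).
    by exists j, (y |: (z |: t)); split; rewrite ?subset_U1.
  have xtq := subset_U1 tq xt.
  move: fc; rewrite cE => /(face_BP u_adm X_I lab_vertex ju (subset_U1 ztq yzt) xtq).
  move=> /fintype.subsetP/(_ x); rewrite !inE eqxx => /(_ isT).
  case/orP=> [/eqP xy|/orP[/eqP xz|xt']].
  - by rewrite cE xy eqxx in cy.
  - by rewrite cE xz eqxx in cz.
  - by move: xt; rewrite inE xt'.
by rewrite rmorph0 rmorphD !rmorphM /kos_sign [z |: (y |: t)]finset.setUCA.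
Qed.

Lemma bdmx_B t y : t \subset q_j -> y \in (q_j :\: t)%SET ->
  bdmx (Some (Bj (y |: t))) (Some (Bj t)) = kos_sign (y |: t) t * 'X_y.
Proof.
move=> tq yt; rewrite /bdmx hdeg_B1 // eqxx; congr (_ * 'X_[_]).
rewrite !(alabel_B u_adm X_I lab_vertex ju) ?subset_U1 //.
apply/mnmP => k; rewrite mnmBE !mnmDE !sqfreeE subnDl mnm1E !inE.
have [->|//] := eqVneq k y; last by rewrite /= subnn.
by move: yt; rewrite inE => /andP[/negbTE->].
Qed.

(** No cell of an earlier stage has a new cell as a facet, so the old coefficients of [f] do not
    enter. *)
Lemma bd_B f t : t \subset q_j -> supported j.+1 f ->
  bd f (Some (Bj t)) = kdiff (fun i => 'X_i) kos_sign q_j (fun s => f (Some (Bj s))) t.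
Proof.
move=> tq fj; rewrite /bd.
rewrite (sum_image (A := (q_j :\: t)%SET) (h := fun y => Some (Bj (y |: t)))).
- by apply: eq_bigr => y yt; rewrite bdmx_B // mulrC.
- move=> y z yt zt [/(Bj_inj (subset_U1 tq yt) (subset_U1 tq zt))] /finset.setP/(_ y).
  by rewrite !inE eqxx => /esym/orP[/eqP//|yt']; move: yt; rewrite inE yt'.
move=> c; have [->|/bdmx_neq0[deg ft]] := eqVneq (bdmx c (Some (Bj t))) 0.
  by rewrite mulr0 eqxx.
move=> nz; apply: cofacet_B => // d dE; apply: contrapT => nd.
by move: nz; rewrite dE fj // mul0r eqxx.
Qed.

(** The new coefficients of [f] form a Koszul cycle, and a Koszul primitive yields [h]. With
    [bd h None = 0], the difference [f - bd h] stays zero at the empty cell. *)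
Lemma exact_step f : supported j.+1 f -> f None = 0 -> (forall c, bd f c = 0) ->
  exists h, [/\ supported j.+1 h, bd h None = 0
             & forall s, s \subset q_j -> f (Some (Bj s)) = bd h (Some (Bj s))].
Proof.
move=> fj f0 f_cyc; pose g s := f (Some (Bj s)).
have [|t tq||g' gE] := @koszul_exact S _ (fun i => 'X_i) _ kos_sign q_j g kos_signsP.
- by move=> r y p; apply: variables_regular.
- by rewrite -bd_B.
- rewrite -variable_gen_span.
  (* The boundary of [f] at the empty cell expresses [g set0] times u_j through earlier
     generators. *)
  have : colon (initial_ideal u j) 'X_[u_[j]] (g finset.set0).
    rewrite /colon /=; have := f_cyc None; rewrite /bd (bigD1 (Some (Bj finset.set0))) //=.
    rewrite bdmx_vertex // => /eqP; rewrite addr_eq0 => /eqP ->.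
    have [_ _ IM] := @ideal_gen_ideal S [set 'X_[m] | m in [set` take j u]].
    rewrite -mulN1r; apply: (IM); apply: bd_initial_ideal; first exact: ltnW.
    move=> c cB c0 cj; apply: fj => /(stageS _ _ _ ju)[//|[s sq cE]].
    move: c0 cB; rewrite cE (XI_dim X_I) ?mem_u // => /cards0_eq ->.
    by rewrite eqxx.
  by case: u_adm => _ _ _ ->.
(* Leaving out the empty set makes [h] vanish on vertices, whence [bd h None = 0]; [kdiff] does not
   read that value of [g']. *)
pose h c :=
  \sum_(s : {set 'I_n} | [&& s \subset q_j, s != finset.set0 & Some (Bj s) == c]) g' s.
have hE s : s \subset q_j -> s != finset.set0 -> h (Some (Bj s)) = g' s.
  move=> sq s0; rewrite /h (bigD1 s) /= ?sq ?s0 ?eqxx // big1 ?addr0 //.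
  by move=> t /andP[/and3P[tq _ /eqP[/(Bj_inj tq sq)->]]]; rewrite eqxx.
have hj : supported j.+1 h.
  move=> c cj; apply: big1 => s /and3P[sq _ /eqP[cE]].
  by case: cj; exists j, s; rewrite cE.
exists h; split=> // [|t tq].
  apply: big1 => -[c|] _; last by rewrite /bdmx mulr0.
  have [->|/bdmx_neq0[/= [c0] _]] := eqVneq (bdmx (Some c) None) 0; first by rewrite mulr0.
  rewrite /h big1 ?mul0r // => s /and3P[sq s0 /eqP[cE]].
  by move: c0 s0; rewrite -cE (XI_dim X_I) ?mem_u // => /cards0_eq ->; rewrite eqxx.
rewrite bd_B // -[LHS]/(g t) gE //; apply: eq_kdiff => y yt.
rewrite hE ?subset_U1 //; apply/finset.set0Pn; exists y; exact: finset.setU11.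
Qed.

End Step.

(** Subtracting the boundary from [exact_step] clears the newest cells and leaves a cycle on the
    previous stage. *)
Lemma bd_exact j f : (j <= size u)%N -> supported j f -> f None = 0 ->
  (forall c, bd f c = 0) -> exists h, forall c, f c = bd h c.
Proof.
elim: j f => [|j IH] f ju fj f0 f_cyc.
  exists (fun=> 0) => c; rewrite /bd big1; last by move=> d _; rewrite mul0r.
  by case: c => // c; apply: fj => -[i [s []]].
have [h [hj h0 fh]] := exact_step ju fj f0 f_cyc.
have [c cj||c|h' fE] := IH (fun c => f c - bd h c) (ltnW ju).
- have [/(stageS _ _ _ ju)[//|[s sq ->]]|cj'] := pselect (stage u q B j.+1 c).
    by rewrite fh // subrr.
  by rewrite fj // (bd_supported ju hj) // subrr.
- by rewrite f0 h0 subrr.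
- by rewrite bdB f_cyc bd_bd subrr.
by exists (fun c => h' c + h c) => c; rewrite bdD -fE subrK.
Qed.

Lemma initial_ideal_size : initial_ideal u (size u) = I.
Proof. by case: u_adm => _ [uI _] _ _; rewrite /initial_ideal take_size. Qed.

Lemma ideal_bd p : I p <-> exists h, p = bd h None.
Proof.
split=> [|[h ->]]; last first.
  rewrite -initial_ideal_size; apply: bd_initial_ideal => // c _ _.
  by have := XI_cells X_I c.
case: u_adm => _ [<- _] _ _ Ip; apply: (Ip [set p | exists h, p = bd h None]).
split; last first.
  move=> _ [w /= wu <-]; exists (fun c => (c == Some (B finset.set0 w))%:R).
  rewrite /bd (bigD1 (Some (B finset.set0 w))) //= eqxx mul1r big1 ?addr0.
    by have /(nthP 0%MM)[i iu <-] := wu; rewrite bdmx_vertex.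
  by move=> c /negbTE->; rewrite mul0r.
split=> [|p1 p2 [h1 ->] [h2 ->]|a p1 [h ->]].
- by exists (fun=> 0); rewrite /bd big1 // => c _; rewrite mul0r.
- by exists (fun c => h1 c + h2 c); rewrite bdD.
- by exists (fun c => a * h c); rewrite /bd mulr_sumr; apply: eq_bigr => c _; rewrite mulrA.
Qed.

(** * Transfer to the graded cellular complex, and minimality *)

Local Notation CC := (cellular_complex K lab eps).

Definition extend i (f : chain CC i) c : S :=
  if insub c is Some c' then f c' else 0.

Lemma extend_val i (f : chain CC i) (c : basis CC i) : extend f (val c) = f c.
Proof. by rewrite /extend valK. Qed.

Lemma extend_deg i (f : chain CC i) c : hdeg c != i -> extend f c = 0.
Proof. by move=> ci; rewrite /extend insubF //; apply: negbTE. Qed.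

Lemma diffE i (f : chain CC i.+1) (c' : basis CC i) : diff f c' = bd (extend f) (val c').
Proof.
rewrite ffunE /bd -(sum_sig (Q := fun c => hdeg c == i.+1)) => [|c ci]; last first.
  by rewrite extend_deg ?mul0r.
apply: eq_bigr => c _; rewrite extend_val /bdmx.
by rewrite (eqP (valP c)) (eqP (valP c')) eqxx.
Qed.

Lemma bd_extend i (f : chain CC i.+1) c : hdeg c != i -> bd (extend f) c = 0.
Proof.
move=> ci; apply: big1 => d _; have [di|di] := eqVneq (hdeg d) i.+1; last first.
  by rewrite extend_deg ?mul0r.
by rewrite /bdmx di eqSS eq_sym (negbTE ci) mulr0.
Qed.

Definition restrict i h : chain CC i := [ffun c => h (val c)].

Lemma diff_restrict i h (c : basis CC i) : diff (restrict i.+1 h) c = bd h (val c).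
Proof.
rewrite diffE; apply: eq_bigr => d _; have [di|di] := eqVneq (hdeg d) i.+1.
  have dP : hdeg d == i.+1 by apply/eqP.
  by rewrite -[d]/(val (exist (fun d => hdeg d == i.+1) d dP)) extend_val ffunE.
by rewrite /bdmx (eqP (valP c)) (negbTE di) !mulr0.
Qed.

(** A homogeneous cycle extended by zero is a cycle in all degrees, zero at the empty cell; the
    primitive from [bd_exact] is cut down to degree [i.+2]. *)
Lemma cellular_exact : exact_positive CC.
Proof.
move=> i f; split=> [f_cyc|[f' ->]]; last first.
  apply/ffunP => c; rewrite diffE ffunE -[RHS](bd_bd (extend f') (val c)).
  apply: eq_bigr => d _; congr (_ * _); have [di|di] := eqVneq (hdeg d) i.+1.
    have dP : hdeg d == i.+1 by apply/eqP.
    by rewrite -[d]/(val (exist (fun d => hdeg d == i.+1) d dP)) extend_val diffE.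
  by rewrite extend_deg // bd_extend.
have [c cN||c|h fE] := @bd_exact (size u) (extend f) (leqnn _).
- by case: cN; exact: XI_cells X_I c.
- by rewrite extend_deg.
- have [ci|ci] := eqVneq (hdeg c) i; last exact: bd_extend.
  have cP : hdeg c == i by apply/eqP.
  rewrite -[c]/(val (exist (fun d => hdeg d == i) c cP)) -diffE.
  by rewrite f_cyc ffunE.
by exists (restrict i.+2 h); apply/ffunP => c; rewrite diff_restrict -fE extend_val.
Qed.

Lemma aug_diff (f : chain CC 1) :
  aug (C := shift CC) (fun v => mat (b := CC) (i := 0) v (empty_cell X)) f
  = diff f (empty_cell X).
Proof. by rewrite /aug ffunE. Qed.

Lemma basis0 (c : basis CC 0) : c = empty_cell X.
Proof. by case: c => -[c|] // cP; apply: val_inj. Qed.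

Lemma ideal_diff p : I p <-> exists f : chain CC 1, p = diff f (empty_cell X).
Proof.
rewrite ideal_bd; split=> [[h ->]|[f ->]]; last by exists (extend f); rewrite diffE.
by exists (restrict 1 h); rewrite diff_restrict.
Qed.

(** The augmentation is the differential onto the empty cell, the only basis element of degree 0, so
    [cellular_exact] also describes its kernel. *)
Lemma cellular_resolves_ideal : resolves_ideal (C := shift CC) I
  (fun v => mat (b := CC) (i := 0) v (empty_cell X)).
Proof.
split=> [p|f|i f]; last exact: (@cellular_exact i.+1 f).
  rewrite ideal_diff; split=> -[f ->]; exists f; by rewrite aug_diff.
rewrite aug_diff -(@cellular_exact 0 f).
split=> [f0|->]; last by rewrite ffunE.
by apply/ffunP => c; rewrite (basis0 c) f0 ffunE.
Qed.

Lemma cellular_resolves_quotient : resolves_quotient (C := CC) I (fun=> 1).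
Proof.
have augE (f : chain CC 0) : aug (fun=> 1) f = f (empty_cell X).
  rewrite /aug (bigD1 (empty_cell X)) //= mulr1 big1 ?addr0 // => c.
  by rewrite (basis0 c) eqxx.
split=> [p|f|]; last exact: cellular_exact.
  exists [ffun=> p]; rewrite augE ffunE subrr -initial_ideal_size.
  by have [] := @ideal_gen_ideal S [set 'X_[m] | m in [set` take (size u) u]].
rewrite augE ideal_diff; split=> -[f' fE]; exists f'; last by rewrite fE.
by apply/ffunP => c; rewrite (basis0 c).
Qed.

(** An entry is a multiple of a quotient of labels, so it suffices that these differ. The premise
    rules out a vertex labelled 1 above the empty cell. *)
Lemma mat_max_ideal i (c : basis CC i.+1) (c' : basis CC i) :
  (val c' = None -> ~ I 1) -> @max_ideal K n (mat c c').
Proof.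
move=> I1; rewrite /mat /=.
have [I0 _ IM] := @ideal_gen_ideal S [set 'X_i | i in [set` [set: 'I_n]%SET]].
have deg : hdeg (val c) = (hdeg (val c')).+1 by rewrite (eqP (valP c)) (eqP (valP c')).
have [cc'|nf] := pselect (aface (val c') (val c)); last first.
  by rewrite (incidence_nonface eps_inc deg nf) mul0r.
apply: IM; apply: max_idealX; apply/eqP => labE.
have lab_eq : alabel lab (val c') = alabel lab (val c).
  by rewrite -(submK (alabel_face lab cc')) labE add0m.
case: (val c) (val c') deg cc' lab_eq I1 => [d|//] [d'|] /=.
  move=> [deg] cc' lab_eq _; have := alabel_facet_neq u_adm X_I lab_vertex cc' deg.
  by rewrite [X in _ != X]/= -lab_eq eqxx.
(* Here the label of the vertex [d] is 1, so a generator divides 1. *)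
move=> [d0] _ lab_eq /(_ erefl); apply.
have [i' [iu _ dE]] := stage_vertex X_I (XI_cells X_I d) d0.
rewrite -initial_ideal_size -mpolyX0; apply/initial_idealX => //; exists i' => //.
rewrite [X in (_ <= X)%MM]lab_eq -/(alabel lab (Some d)) dE.
by rewrite (alabel_B u_adm X_I lab_vertex) ?finset.sub0set ?lem_addr.
Qed.

Lemma diff_max_ideal i (f : chain CC i.+1) (c : basis CC i) :
  (val c = None -> ~ I 1) -> @max_ideal K n (diff f c).
Proof.
move=> I1; rewrite ffunE.
have IJ := @ideal_gen_ideal S [set 'X_i | i in [set` [set: 'I_n]%SET]].
by apply: (ideal_sum _ IJ) => d _; case: IJ => _ _; apply; apply: mat_max_ideal.
Qed.

End Resolution.

Theorem theorem4p3 (K : fieldType) (n : nat) (I : set {mpoly K[n]})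
    (u : seq 'X_{1..n}) (q : 'X_{1..n} -> {set 'I_n})
    (R : realType) (X : regular_cell_complex R)
    (B : {set 'I_n} -> 'X_{1..n} -> cell X) (lab : cell X -> 'X_{1..n}) :
  monomial_ideal I ->
  admissible I u q ->
  regular_decomp K u q ->
  is_X_I K u q B ->
  (forall w, w \in u -> lab (B finset.set0 w) = w) ->
  supports_minimal_resolution lab I.
Proof.
move=> _ u_adm _ X_I lab_vertex eps eps_inc; split=> [|I1]; split.
- exact: (cellular_resolves_ideal u_adm X_I lab_vertex eps_inc).
(* The shifted complex has no empty cell in its bases, so the premise is vacuous. *)
- move=> i f c; apply: (diff_max_ideal u_adm X_I lab_vertex eps_inc (i := i.+1)).
  by case: c => -[].
- exact: (cellular_resolves_quotient u_adm X_I lab_vertex eps_inc).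
- by move=> i f c; apply: (diff_max_ideal u_adm X_I lab_vertex eps_inc).
Qed.
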